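(* Let $q$ be a prime power and let $u$ be a positive integer with $u\mid q+1$ and $u\ne q+1$. Let $C_H=C_{\mathcal L}(D_H,\alpha_HP_\infty)$ be a one-point code on the Hermitian curve $y^q+y=x^{q+1}$ over $\mathbb F_{q^2}$, where $D_H$ is the sum of the $n_H=q^3$ affine $\mathbb F_{q^2}$-rational points, and let $C_{ENT}=C_{\mathcal L}(D_{ENT},\alpha_{ENT}P_\infty)$ be a one-point code on the extended norm--trace curve $y^q+y=x^u$ over $\mathbb F_{q^2}$, where $D_{ENT}$ is the sum of the $n_{ENT}=q+u(q^2-q)$ affine $\mathbb F_{q^2}$-rational points. Let $g_{ENT}=\frac{(u-1)(q-1)}{2}$ be the genus of the extended norm--trace curve, let $d_H^\perp,d_{ENT}^\perp$ be the minimum distances of the dual codes $C_H^\perp,C_{ENT}^\perp$, and let $\ell_H=\left\lfloor\frac{d_H^\perp-1}{2}\right\rfloor$, $\ell_{ENT}=\left\lfloor\frac{d_{ENT}^\perp-1}{2}\right\rfloor$. If $$\alpha_{ENT}\ \ge\ 2g_{ENT}+2\left\lfloor\frac{n_{ENT}}{n_H}\ell_H\right\rfloor+1,$$ then $\frac{\ell_{ENT}}{n_{ENT}}>\frac{\ell_H}{n_H}$. Consequently, for a fixed constraint density $\rho=r/q^2$ (the same for both codes), the expected DQI satisfaction fraction obtained from $C_{ENT}$ (COFI) is strictly larger than the one obtained from $C_H$ (HOPI) whenever both instances lie in the nonsaturated regime; if both are saturated, both fractions equal $1$.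
   Context: Each curve means its smooth projective model, which has a unique point at infinity $P_\infty$. For a sum $D=P_1+\cdots+P_n$ of distinct rational points not in $\operatorname{supp}(G)$, $C_{\mathcal L}(D,G)=\{(f(P_1),\dots,f(P_n)) : f\in\mathcal L(G)\}$, where $\mathcal L(G)=\{f : (f)\ge -G\}\cup\{0\}$. Duals are with respect to the standard bilinear form, distances are Hamming distances, and minimum distance is defined for nonzero codes, so the dual codes are taken to be nonzero. COFI/HOPI: given constraint sets $F_i$ of size $r$ in the field, find $f\in\mathcal L(G)$ maximizing $|\{i: f(P_i)\in F_i\}|$ (HOPI is the case of one-point Hermitian codes). DQI expected satisfaction fraction: for a code of length $n$ whose dual has decoding radius $\ell=\lfloor(d^\perp-1)/2\rfloor$ and constraint density $\rho$ (constraint-set size divided by alphabet size), it is given (semicircle law, taken as definition) by $$\frac sn=\begin{cases}\left(\sqrt{\frac{\ell}{n}(1-\rho)}+\sqrt{\rho\left(1-\frac{\ell}{n}\right)}\right)^2,&\text{if }\rho\le 1-\frac{\ell}{n}\quad(\text{nonsaturated}),\\ 1,&\text{otherwise}\quad(\text{saturated}).\end{cases}$$ *)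

(* Defs.v *)
From HB Require Import structures.
From mathcomp Require Import all_boot all_order all_algebra all_field.
From mathcomp Require Import boolp reals.
Set Implicit Arguments.
Unset Strict Implicit.
Unset Printing Implicit Defensive.
Import Order.TTheory GRing.Theory Num.Theory.
Local Open Scope ring_scope.

(** A smooth projective curve over [K] is handled through its function field:
    its closed points are the places of the function field over [K], i.e. the
    normalized discrete valuations that are trivial on [K]. *)

(** ** The curves y^q + y = x^u *)

(** The function field K(x, y): a finite extension of the rational function
    field K(x), generated by [nt_y], whose minimal polynomial over K(x) is
    T^q + T - x^u. The field is unique up to isomorphism. *)
Record nt_curve (K : fieldType) (q u : nat) := NTCurve {
  nt_field :> fieldExtType {fraction {poly K}};
  nt_y : nt_field;
  nt_gen : <<1; nt_y>>%VS = fullv;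
  nt_eqn : minPoly 1 nt_y =
    'X^q + 'X - (((FracField.tofrac ('X : {poly K}))%:A : nt_field) ^+ u)%:P
}.

(** The Hermitian curve is the case u = q + 1. *)
Definition hermitian_curve (K : fieldType) (q : nat) := nt_curve K q q.+1.

Section Places.
Variables (K : fieldType) (q u : nat) (X : nt_curve K q u).

Definition nt_const (c : K) : X := (FracField.tofrac c%:P)%:A.
Definition nt_x : X := (FracField.tofrac ('X : {poly K}))%:A.

(** The order of 0 is +oo; here [place_val] takes the dummy value 0 at 0 (so
    that a place is determined by its valuation), and every use below treats
    the zero function separately. *)
Record place := Place {
  place_val :> X -> int;
  place_val0 : place_val 0 = 0;
  place_valM : forall f g, f != 0 -> g != 0 ->
    place_val (f * g) = place_val f + place_val g;
  place_valD : forall f g, f != 0 -> g != 0 -> f + g != 0 ->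
    Num.min (place_val f) (place_val g) <= place_val (f + g);
  place_val_const : forall c : K, c != 0 -> place_val (nt_const c) = 0;
  place_val_norm : exists f, f != 0 /\ place_val f = 1
}.

Definition at_infinity (P : place) : Prop := P nt_x < 0 \/ P (nt_y X) < 0.

(** f(P) = c : the function f - c vanishes at P. *)
Definition has_value (P : place) (f : X) (c : K) : Prop :=
  f = nt_const c \/ 0 < P (f - nt_const c).

(** Degree one: the residue field at P is K. *)
Definition rational_place (P : place) : Prop :=
  forall f : X, f = 0 \/ 0 <= P f -> exists c : K, has_value P f c.

(** D_1, ..., D_n are the affine rational points, each listed once. *)
Definition affine_rational_points (n : nat) (D : 'I_n -> place) : Prop :=
  injective D /\
  forall P : place,
    (exists i, D i = P) <-> rational_place P /\ ~ at_infinity P.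

(** A divisor is given by its coefficients. *)
Definition one_point_divisor (alpha : int) (P : place) : place -> int :=
  fun Q => if `[< Q = P >] then alpha else 0.

Definition RRspace (G : place -> int) (f : X) : Prop :=
  f = 0 \/ forall P : place, - G P <= P f.

End Places.

(** C_L(D, G) *)
Definition AGcode (K : finFieldType) (q u : nat) (X : nt_curve K q u)
    (n : nat) (D : 'I_n -> place X) (G : place X -> int) : {set 'rV[K]_n} :=
  [set c : 'rV[K]_n | `[< exists f : X,
                 RRspace G f /\ forall i, has_value (D i) f (c 0 i) >]].

(** ** Linear codes *)
Section Codes.
Variables (K : finFieldType) (n : nat).
Implicit Types (x y : 'rV[K]_n) (C : {set 'rV[K]_n}).

Definition hamming x y : nat := #|[set i | x 0 i != y 0 i]|.

Definition dual_code C : {set 'rV[K]_n} :=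
  [set x : 'rV[K]_n | [forall y : 'rV[K]_n in C, \sum_i x 0 i * y 0 i == 0]].

Definition nonzero_code C : Prop := exists2 x, x \in C & x != 0.

(** Meaningful when C has two distinct words; distances never exceed n, so
    the neutral value n does not affect the minimum. *)
Definition min_distance C : nat :=
  \big[minn/n]_(x in C) \big[minn/n]_(y in C | x != y) hamming x y.

(** The decoding radius of the dual code: the floor of (d - 1) / 2 with d the
    minimum distance of the dual. *)
Definition dual_radius C : nat := ((min_distance (dual_code C) - 1) %/ 2)%N.

End Codes.

(** ** DQI: the semicircle law *)
Section DQI.
Variables (R : realType) (K : finFieldType) (n : nat).
Implicit Types (C : {set 'rV[K]_n}) (rho : R).

Definition relative_radius C : R := (dual_radius C)%:R / n%:R.

Definition nonsaturated C rho : Prop := rho <= 1 - relative_radius C.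

Definition dqi_fraction C rho : R :=
  if rho <= 1 - relative_radius C then
    (Num.sqrt (relative_radius C * (1 - rho)) +
     Num.sqrt (rho * (1 - relative_radius C))) ^+ 2
  else 1.

End DQI.

(* Main.v *)
(** The decoding radius only needs the Goppa bound d_ENT^perp >= alpha + 2 - 2g,
    which follows by the Feng-Rao argument. Let c be a nonzero dual word, let
    phi(f) = sum_k c_k f(P_k), and let N be the least weight q i + u j of a
    monomial with phi(x^i y^j) <> 0; then N > alpha, because monomials of weight
    at most alpha lie in L(alpha P_oo). If c had smaller weight than the number
    of a such that a and N - a both lie in the semigroup <q, u>, some combination
    of the corresponding monomials f_a would vanish on the support of c;
    multiplying it by f_(N - b), with b its largest weight, gives a function of
    weight N on which phi is nonzero, a contradiction. By the symmetry of
    <q, u>, there are at least N + 1 - 2g such a.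

    For this, P_oo has to be the only place at infinity (the weights
    q i + u j with j < q are pairwise distinct, so they determine the valuation)
    and an affine rational place has to be determined by its coordinates (the
    affine curve is smooth, with uniformizer x - x_0). *)

Require Import Defs.
From HB Require Import structures.
From mathcomp Require Import all_boot all_order all_algebra all_field.
From mathcomp Require Import boolp reals.
From mathcomp Require Import zify ring lra.
Set Implicit Arguments.
Unset Strict Implicit.
Unset Printing Implicit Defensive.
Import Order.TTheory GRing.Theory Num.Theory.
Local Open Scope ring_scope.

(** * The Feng-Rao bound *)

Section NumericalSemigroup.
Local Open Scope nat_scope.
Variables (q u : nat).
Hypotheses (q_gt0 : 0 < q) (coqu : coprime q u).

(** Since q copies of u equal u copies of q, coefficients of u below q suffice, and membership
    becomes a boolean. *)
Definition in_semigroup (a : nat) : bool :=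
  [exists j : 'I_q, (u * j <= a) && (q %| a - u * j)].

Lemma in_semigroupP a :
  reflect (exists ij : nat * nat, a = q * ij.1 + u * ij.2) (in_semigroup a).
Proof.
apply: (iffP existsP) => [[j /andP[le_j /dvdnP[i Di]]]|[[i j] /= ->]].
  by exists (i, nat_of_ord j); rewrite /= mulnC -Di subnK.
exists (Ordinal (ltn_pmod j q_gt0)) => /=.
rewrite [in q * i + _](divn_eq j q) mulnDr addnA leq_addl addnK.
by rewrite mulnA; apply: dvdn_add; [apply: dvdn_mulr | apply: dvdn_mull].
Qed.

Lemma modn_inv_exists a : exists2 j, j < q & u * j = a %[mod q].
Proof.
case: (altP (q =P 1)) => [-> | q_neq1]; first by exists 0; rewrite ?modn1.
have u_gt0 : 0 < u.
  by case: (posnP u) coqu => // ->; rewrite /coprime gcdn0 (negbTE q_neq1).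
case: (egcdnP q u_gt0) => t s; rewrite gcdnC (eqnP coqu) => Dt _.
exists ((t * a) %% q); first exact: ltn_pmod.
by rewrite modnMmr mulnA (mulnC u) Dt mulnDl mul1n mulnAC modnMDl.
Qed.

(** This is the symmetry of the semigroup. Take j < q with u j congruent to a modulo q. If a is a
    gap, then u j - a = k q with k > 0, and (q-1)(u-1) - 1 - a = q (k-1) + u (q-1-j). *)
Lemma semigroup_gap a : ~~ in_semigroup a ->
  a < (q - 1) * (u - 1) /\ in_semigroup ((q - 1) * (u - 1) - a.+1).
Proof.
have [j ltjq Dj] := modn_inv_exists a.
case: (leqP (u * j) a) => [leja | ltaj].
  move/eqP: Dj; rewrite eq_sym eqn_mod_dvd // => dvd_j.
  by case/negP; apply/existsP; exists (Ordinal ltjq); rewrite /= leja.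
move/eqP: Dj; rewrite eqn_mod_dvd ?(ltnW ltaj) // => /dvdnP[k Dk] _.
have k_gt0 : 0 < k by case: k Dk => // Dk; lia.
have Da : (q - 1) * (u - 1) = a.+1 + (q * (k - 1) + u * (q - 1 - j)) .
  have [j' Dq] : exists j', q = (j + j').+1 by exists (q - j.+1); lia.
  case: k k_gt0 Dk => // k _ Dk; case: u ltaj Dk => [|v]; first by lia.
  by rewrite Dq !subn1 /= addKn => ltaj Dk; lia.
split; first by rewrite Da leq_addr.
by apply/in_semigroupP; exists (k - 1, q - 1 - j); rewrite /= Da addKn.
Qed.

(** All gaps lie below T = (q-1)(u-1), and the reflection of a to T - 1 - a sends gaps to non-gaps,
    so at most half of the numbers below T are gaps. *)
Lemma sum_gaps_le n : 2 * \sum_(a < n) ~~ in_semigroup a <= (q - 1) * (u - 1).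
Proof.
set T := (q - 1) * (u - 1).
have le_nT : \sum_(a < n) ~~ in_semigroup a <= \sum_(a < T) ~~ in_semigroup a.
  rewrite -(big_mkord xpredT (fun a => ~~ in_semigroup a : nat)).
  rewrite -(big_mkord xpredT (fun a => ~~ in_semigroup a : nat)).
  have -> : \sum_(0 <= a < T) ~~ in_semigroup a
          = \sum_(0 <= a < T + n) ~~ in_semigroup a.
    rewrite (big_cat_nat (leq0n _) (leq_addr n T)) /=.
    rewrite -[LHS]addn0; congr (_ + _); symmetry.
    rewrite big_nat_cond big1 // => a.
    rewrite andbT => /andP[leTa _]; apply/eqP; rewrite eqb0.
    by apply/negP => /semigroup_gap[]; rewrite ltnNge leTa.
  by rewrite addnC (big_cat_nat (leq0n _) (leq_addr T n)) /= leq_addr.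
rewrite (leq_trans (n := 2 * \sum_(a < T) ~~ in_semigroup a)) ?leq_mul2l //.
rewrite mul2n -addnn {1}(reindex_inj rev_ord_inj) -big_split /=.
rewrite -[leqRHS]card_ord -sum1_card leq_sum // => a _.
have [|/semigroup_gap[_ ->]] := boolP (in_semigroup a); last by [].
by rewrite addn0 leq_b1.
Qed.

(** Each a <= n outside the set makes a or n - a a gap. By reflection, both cases are counted by the
    number of gaps up to n. *)
Lemma semigroup_pairs_card n :
  n < #|[set a : 'I_n.+1 | in_semigroup a && in_semigroup (n - a)]|
        + (q - 1) * (u - 1).
Proof.
set A := #|_|.
apply: (@leq_trans (A + 2 * \sum_(a < n.+1) ~~ in_semigroup a)); last first.
  by rewrite leq_add2l sum_gaps_le.
rewrite mul2n -addnn {1}(reindex_inj rev_ord_inj) /A -sum1_card big_mkcond.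
rewrite -!big_split /= -[leqLHS]card_ord -sum1_card leq_sum // => a _.
by rewrite inE subSS; case: in_semigroup; case: in_semigroup.
Qed.

Lemma same_weight i j i' j' : q * i + u * j = q * i' + u * j' -> j <= j' ->
  exists k, i = i' + u * k /\ j' = j + q * k.
Proof.
move=> eqw lejj'.
have : q %| u * (j' - j).
  by apply/dvdnP; exists (i - i'); rewrite mulnBr mulnBl; nia.
rewrite Gauss_dvdr // => /dvdnP[k Dk]; exists k; split; last by lia.
have Dj : j' = j + q * k by lia.
by apply/eqP; rewrite -(eqn_pmul2l q_gt0); apply/eqP; rewrite Dj in eqw; lia.
Qed.

End NumericalSemigroup.

(** A homogeneous system with more unknowns than equations has a nonzero solution, taken here in the
    left kernel of the matrix of [F] restricted to [A] and [S]. *)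
Lemma exists_vanishing (K : fieldType) (I J : finType) (A : {set I})
    (S : {set J}) (F : I -> J -> K) : (#|S| < #|A|)%N ->
  exists v : I -> K, (exists2 i, i \in A & v i != 0) /\
    forall j, j \in S -> \sum_(i in A) v i * F i j = 0.
Proof.
move=> ltSA; pose M := \matrix_(i < #|A|, j < #|S|) F (enum_val i) (enum_val j).
have /rowV0Pn[r /sub_kermxP rM0 r_neq0] : kermx M != 0.
  rewrite kermx_eq0 /row_free neq_ltn; apply/orP; left.
  exact: leq_ltn_trans (rank_leq_col M) ltSA.
have [i0 ri0] : exists i, r 0 i != 0.
  apply/existsP; rewrite -negb_forall; apply: contra r_neq0 => /forallP r0.
  by apply/eqP/rowP => i; rewrite mxE; apply/eqP.
have Ai0 := enum_valP i0.
exists (fun i => r 0 (enum_rank_in Ai0 i)); split.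
  by exists (enum_val i0); rewrite ?enum_valK_in ?Ai0.
move=> j Sj; move/rowP/(_ (enum_rank_in Sj j)): rM0; rewrite !mxE => rMj.
rewrite -[RHS]rMj [LHS]big_enum_val /=; apply: eq_bigr => i _.
by rewrite mxE enum_valK_in enum_rankK_in.
Qed.

(** * Moments of a word on points of the curve, and the weight bound *)

Section FengRao.
Variables (K : finFieldType) (q u n : nat) (x y c : 'I_n -> K).
Hypotheses (q_gt1 : (1 < q)%N) (coqu : coprime q u) (u_gt0 : (0 < u)%N).
Hypothesis curve_eqn : forall k, y k ^+ q + y k = x k ^+ u.
Hypothesis xy_inj : forall k l, x k = x l -> y k = y l -> k = l.
Hypothesis c_neq0 : exists k, c k != 0.

Definition moment (i j : nat) : K := \sum_k c k * (x k ^+ i * y k ^+ j).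

(** If all moments vanished, so would the sum of c_k p(x_k) r(y_k) for all polynomials p and r.
    Interpolation polynomials in x and in y single out one point k with c_k nonzero, because points
    are determined by their coordinates. *)
Lemma moment_neq0 : exists i j, moment i j != 0.
Proof.
apply: contrapT => all0.
have mom0 i j : moment i j = 0.
  by apply/eqP/negPn/negP => h; apply: all0; exists i, j.
have poly0 (p r : {poly K}) : \sum_k c k * (p.[x k] * r.[y k]) = 0.
  transitivity (\sum_(i < size p) \sum_(j < size r) p`_i * r`_j * moment i j).
    under [RHS]eq_bigr do under eq_bigr do rewrite mulr_sumr.
    under [RHS]eq_bigr do rewrite exchange_big /=.
    rewrite exchange_big /=; apply: eq_bigr => k _.
    rewrite !horner_coef big_distrlr /= mulr_sumr; apply: eq_bigr => i _.
    by rewrite mulr_sumr; apply: eq_bigr => j _; ring.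
  by rewrite big1 // => i _; rewrite big1 // => j _; rewrite mom0 mulr0.
have [k ck] := c_neq0.
pose L (a : K) : {poly K} := \prod_(b | b != a) ('X - b%:P).
have L0 a b : (L a).[b] != 0 -> b = a.
  apply: contraNeq => neq_ba; apply/eqP.
  by rewrite horner_prod (bigD1 b) //= hornerXsubC subrr mul0r.
have L1 a : (L a).[a] != 0.
  rewrite horner_prod; apply/prodf_neq0 => b neq_ba.
  by rewrite hornerXsubC subr_eq0 eq_sym.
move/eqP: (poly0 (L (x k)) (L (y k))); apply/negP.
rewrite (bigD1 k) //= big1 ?addr0 => [|l neq_lk].
  by rewrite !mulf_neq0.
apply/eqP; rewrite !mulf_eq0; apply/or3P.
have [_|/L0 xl] := eqVneq (L (x k)).[x l] 0; first by constructor 2.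
have [_|/L0 yl] := eqVneq (L (y k)).[y l] 0; first by constructor 3.
by rewrite (xy_inj xl yl) eqxx in neq_lk.
Qed.

Lemma moment_shift i j :
  moment i (j + q) = moment (i + u) j - moment i j.+1.
Proof.
rewrite /moment -sumrB; apply: eq_bigr => k _.
rewrite !exprD -curve_eqn exprS; ring.
Qed.

Section Leading.
Variable N : nat.
Hypothesis below : forall i j, (q * i + u * j < N)%N -> moment i j = 0.

(** Exponents of equal weight differ by a multiple of (u, -q). Each step trades y^q for x^u - y, and
    the extra term has weight N - u (q-1) < N, hence moment zero. *)
Lemma moment_same_weight i j i' j' : (q * i + u * j)%N = N ->
  (q * i' + u * j')%N = N -> moment i j = moment i' j'.
Proof.
wlog lejj' : i j i' j' / (j <= j')%N.
  by move=> IH; case/orP: (leq_total j j') => h *; [|symmetry]; apply: IH.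
move=> Dij Dij'; have q_gt0 := ltnW q_gt1.
have [k [Di Dj']] := same_weight q_gt0 coqu (etrans Dij (esym Dij')) lejj'.
rewrite Di Dj'; rewrite Di in Dij; elim: k => [|k IH] in i' Dij {Dij' Di Dj'} *.
  by rewrite !muln0 !addn0.
rewrite [in RHS]mulnS [in RHS](addnC q) addnA moment_shift.
rewrite [X in _ = _ - X]below ?subr0.
  by rewrite -IH ?mulnS ?addnA //; rewrite -Dij; lia.
by rewrite -Dij; nia.
Qed.

Lemma weight_ge_pairs i0 j0 : (q * i0 + u * j0)%N = N -> moment i0 j0 != 0 ->
  (#|[set a : 'I_N.+1 | in_semigroup q u a && in_semigroup q u (N - a)]|
    <= #|[set k | c k != 0%R]|)%N.
Proof.
move=> Dij0 mom_neq0; rewrite leqNgt; apply/negP.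
set A := [set a : 'I_N.+1 | _].
(* [e a] is a pair of exponents of weight a; off the semigroup it is the dummy (0, 0). *)
have /choice[e De] : forall a, exists ij : nat * nat,
    in_semigroup q u a -> a = (q * ij.1 + u * ij.2)%N.
  move=> a.
  have [/(in_semigroupP u (ltnW q_gt1))[ij ->]|_] := boolP (in_semigroup q u a).
    by exists ij.
  by exists (0, 0)%N.
pose f a k := x k ^+ (e a).1 * y k ^+ (e a).2.
case/(exists_vanishing (fun (a : 'I_N.+1) k => f a k)) => v [[a0 Aa0 va0] v0].
have [b /andP[Ab vb] maxb] :=
  @arg_maxnP _ a0 (fun a => (a \in A) && (v a != 0)) (@nat_of_ord _)
    (introT andP (conj Aa0 va0)).
have [sgb sgNb] : in_semigroup q u b /\ in_semigroup q u (N - b).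
  by apply/andP; move: Ab; rewrite inE.
(* [m a] is phi(f_a f_(N-b)), of weight a + N - b. This is N for a = b and less than N for every
   other a with v_a nonzero, by maximality of b. *)
pose m a := moment ((e a).1 + (e (N - b)%N).1) ((e a).2 + (e (N - b)%N).2).
have : \sum_(a in A) v a * m a = 0.
  transitivity (\sum_k c k * (\sum_(a in A) v a * f a k) * f (N - b)%N k).
    under [RHS]eq_bigr do rewrite mulr_sumr mulr_suml.
    rewrite exchange_big /=; apply: eq_bigr => a _.
    by rewrite mulr_sumr; apply: eq_bigr => k _; rewrite /f !exprD; ring.
  rewrite big1 // => k _; have [->|ck] := eqVneq (c k) 0.
    by rewrite !mul0r.
  by rewrite v0 ?mulr0 ?mul0r // inE.
apply/eqP; rewrite (bigD1 b) //= big1 ?addr0 => [|a /andP[Aa neq_ab]].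
  rewrite mulf_neq0 // /m (@moment_same_weight _ _ i0 j0) //.
  by move: (De _ sgb) (De _ sgNb) (ltn_ord b); lia.
have [->|va] := eqVneq (v a) 0; first by rewrite mul0r.
have ltab : (a < b)%N by rewrite ltn_neqAle neq_ab; apply: maxb; rewrite Aa.
rewrite /m below ?mulr0 //; move: Aa; rewrite inE => /andP[sga _].
by move: (De _ sga) (De _ sgNb) (ltn_ord b) ltab; lia.
Qed.

End Leading.

Lemma feng_rao s : (forall i j, (q * i + u * j < s)%N -> moment i j = 0) ->
  (s < #|[set k | c k != 0%R]| + (q - 1) * (u - 1))%N.
Proof.
(* N is the least weight carrying a nonzero moment, so s <= N. *)
move=> mom0; pose P N := `[< exists i j, (q * i + u * j)%N = N /\ moment i j != 0 >].
have exP : exists N, P N.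
  have [i [j mij]] := moment_neq0.
  by exists (q * i + u * j)%N; apply/asboolP; exists i, j.
case: (ex_minnP exP) => N /asboolP[i [j [Dij mij]]] minN.
have below i' j' : (q * i' + u * j' < N)%N -> moment i' j' = 0.
  move=> lt_N; apply/eqP/negPn/negP => m'; move: lt_N; rewrite ltnNge minN //.
  by apply/asboolP; exists i', j'.
have le_sN : (s <= N)%N.
  by rewrite leqNgt -Dij; apply: contra mij => /mom0->.
apply: leq_ltn_trans le_sN _.
apply: leq_trans (semigroup_pairs_card (ltnW q_gt1) coqu N) _.
by rewrite leq_add2r (weight_ge_pairs below Dij).
Qed.

End FengRao.

(** * Places of the curve y^q + y = x^u *)

Section Valuations.
Variables (K : fieldType) (q u : nat) (X : nt_curve K q u).
Implicit Types (P Q : place X) (f g : X).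

Definition poly_x : {poly K} -> X := in_alg X \o @FracField.tofrac {poly K}.
HB.instance Definition _ := GRing.RMorphism.on poly_x.
Definition const : K -> X := poly_x \o polyC.
HB.instance Definition _ := GRing.RMorphism.on const.

Lemma poly_x_inj : injective poly_x.
Proof.
by move=> a b /fmorph_inj /eqP; rewrite tofrac_eq => /eqP.
Qed.

Lemma poly_x_eq0 a : (poly_x a == 0) = (a == 0).
Proof. by rewrite -(inj_eq poly_x_inj) rmorph0. Qed.

Lemma poly_xX : poly_x 'X = nt_x X. Proof. by []. Qed.

Lemma nt_constE c : nt_const X c = const c. Proof. by []. Qed.

Lemma val1 P : P 1 = 0.
Proof.
have := @place_valM _ _ _ _ P 1 1 (oner_neq0 _) (oner_neq0 _).
by rewrite mulr1; lia.
Qed.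

Lemma val_const P c : P (const c) = 0.
Proof.
have [->|c0] := eqVneq c 0; first by rewrite rmorph0 place_val0.
by rewrite -nt_constE place_val_const.
Qed.

Lemma valN P f : P (- f) = P f.
Proof.
have [->|f0] := eqVneq f 0; first by rewrite oppr0.
have -> : - f = const (-1) * f by rewrite rmorphN1 mulN1r.
by rewrite place_valM // ?val_const ?add0r // rmorphN1 oppr_eq0 oner_neq0.
Qed.

Lemma valX P f n : P (f ^+ n) = P f * n%:Z.
Proof.
have [->|f0] := eqVneq f 0.
  by case: n => [|n]; rewrite ?val1 ?mulr0 // expr0n /= place_val0 mul0r.
elim: n => [|n IH]; first by rewrite val1 mulr0.
by rewrite exprS place_valM ?expf_neq0 // IH; lia.
Qed.

Lemma valD_ge P f g m : f != 0 -> g != 0 -> f + g != 0 ->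
  m <= P f -> m <= P g -> m <= P (f + g).
Proof.
move=> f0 g0 fg0 mf mg; apply: le_trans (place_valD P f0 g0 fg0).
by rewrite le_min mf.
Qed.

(** If the sum had order greater than P f, then f = (f + g) - g would have order at least P f +
    1. *)
Lemma valD_lt P f g : f != 0 -> g != 0 -> P f < P g ->
  f + g != 0 /\ P (f + g) = P f.
Proof.
move=> f0 g0 ltfg; have fg0 : f + g != 0.
  by apply: contraTneq ltfg => /eqP; rewrite addr_eq0 => /eqP->; rewrite valN ltxx.
split=> //; apply/eqP; rewrite eq_le valD_ge ?(ltW ltfg) // andbT leNgt.
apply/negP => ltf; have gN0 : - g != 0 by rewrite oppr_eq0.
have := @valD_ge P (f + g) (- g) (P f + 1) fg0 gN0.
by rewrite addrK valN => /(_ f0); lia.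
Qed.

(** The valuation ring at P and, next, its maximal ideal. Zero is a separate case because its order
    is the dummy value 0. *)
Definition integral P f := f = 0 \/ 0 <= P f.
Definition vanishes P f := f = 0 \/ 0 < P f.

Lemma integralP P f : integral P f <-> 0 <= P f.
Proof.
by split=> [[->|]|]; rewrite ?place_val0 //; right.
Qed.

Lemma vanishes_integral P f : vanishes P f -> integral P f.
Proof. by case=> [->|/ltW]; [left|right]. Qed.

Lemma integralD P f g : integral P f -> integral P g -> integral P (f + g).
Proof.
have [->|f0] := eqVneq f 0; first by rewrite add0r.
have [->|g0] := eqVneq g 0; first by rewrite addr0.
have [->|fg0] := eqVneq (f + g) 0; first by left.
by rewrite !integralP; apply: valD_ge.
Qed.

Lemma vanishesD P f g : vanishes P f -> vanishes P g -> vanishes P (f + g).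
Proof.
have [->|f0] := eqVneq f 0; first by rewrite add0r.
have [->|g0] := eqVneq g 0; first by rewrite addr0.
have [->|fg0] := eqVneq (f + g) 0; first by left.
move=> [/eqP|f1]; first by rewrite (negbTE f0).
move=> [/eqP|g1]; first by rewrite (negbTE g0).
by right; apply: (@valD_ge P f g 1).
Qed.

Lemma vanishesM P f g : vanishes P f -> integral P g -> vanishes P (f * g).
Proof.
have [->|f0] := eqVneq f 0; first by rewrite mul0r.
have [->|g0] := eqVneq g 0; first by rewrite mulr0; left.
move=> [/eqP|f1]; first by rewrite (negbTE f0).
by move/integralP=> g1; right; rewrite place_valM //; lia.
Qed.

Lemma has_valueE P f c : has_value P f c <-> vanishes P (f - const c).
Proof.
by split=> -[|?]; try (by right); [move=> ->|move/subr0_eq]; left; rewrite ?subrr.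
Qed.

Lemma const_integral P c : integral P (const c).
Proof. by apply/integralP; rewrite val_const. Qed.

Lemma has_value_integral P f c : has_value P f c -> integral P f.
Proof.
move/has_valueE/vanishes_integral => fc.
by have := integralD fc (const_integral P c); rewrite subrK.
Qed.

Lemma has_value_const P c : has_value P (const c) c.
Proof. by left. Qed.

Lemma has_valueD P f g c d :
  has_value P f c -> has_value P g d -> has_value P (f + g) (c + d).
Proof.
move=> /has_valueE vf /has_valueE vg; apply/has_valueE.
by have := vanishesD vf vg; rewrite addrACA -opprD rmorphD.
Qed.

Lemma has_valueM P f g c d :
  has_value P f c -> has_value P g d -> has_value P (f * g) (c * d).
Proof.
move=> vf vg; apply/has_valueE; rewrite rmorphM.
have -> : f * g - const c * const d = (f - const c) * g + (g - const d) * const c.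
  by ring.
apply: vanishesD; apply: vanishesM; try exact/has_valueE.
  exact: has_value_integral vg.
exact: const_integral.
Qed.

Lemma has_valueX P f c n : has_value P f c -> has_value P (f ^+ n) (c ^+ n).
Proof.
move=> vf; elim: n => [|n IH]; last by rewrite !exprS; apply: has_valueM.
by rewrite !expr0 -[X in has_value P X](rmorph1 const); apply: has_value_const.
Qed.

Lemma has_value_neq0 P f c : has_value P f c -> c != 0 -> f != 0 /\ P f = 0.
Proof.
move=> vf c0; have cX0 : const c != 0 by rewrite fmorph_eq0.
have [fc|fc] := eqVneq (f - const c) 0.
  by rewrite (subr0_eq fc) val_const.
case/has_valueE: vf => [/eqP|lt0]; first by rewrite (negbTE fc).
have := @valD_lt P (const c) (f - const c) cX0 fc.
by rewrite [const c + _]addrC subrK val_const => /(_ lt0).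
Qed.

Lemma has_value_uniq P f c d : has_value P f c -> has_value P f d -> c = d.
Proof.
move=> vc vd; apply/eqP; rewrite -subr_eq0; apply/negPn/negP => cd0.
have := has_valueD vc (has_valueM (has_value_const P (-1)) vd).
rewrite rmorphN1 !mulN1r subrr => v0.
by have [] := has_value_neq0 v0 cd0; rewrite eqxx.
Qed.

Lemma place_eq P Q : P =1 Q -> P = Q.
Proof.
case: P Q => [v h1 h2 h3 h4 h5] [w k1 k2 k3 k4 k5] /= /funext eqvw.
case: w / eqvw in k1 k2 k3 k4 k5 *.
by f_equal; apply: Prop_irrelevance.
Qed.

(* Since both valuations are normalized, the scaling factors must be 1. *)
Lemma proportional_places P Q (e e' : int) : 0 < e -> 0 < e' ->
  (forall f, f != 0 -> exists m : int, P f = m * e /\ Q f = m * e') ->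
  e = 1 /\ P = Q.
Proof.
move=> e_gt0 e'_gt0 prop.
have [f [/prop[m [-> _]] m1]] := place_val_norm P.
have [g [/prop[m' [_ ->]] m1']] := place_val_norm Q.
have unit_eq1 (k l : int) : k * l = 1 -> 0 < l -> l = 1.
  by move/(congr1 absz)/eqP; rewrite abszM muln_eq1 => /andP[_ /eqP]; lia.
have De := unit_eq1 _ _ m1 e_gt0; have De' := unit_eq1 _ _ m1' e'_gt0.
split=> //; apply: place_eq => h.
have [->|/prop[k [-> ->]]] := eqVneq h 0; first by rewrite !place_val0.
by rewrite De De'.
Qed.

End Valuations.

Arguments poly_x {K q u X}.
Arguments const {K q u X}.

(** * Clearing denominators *)

Lemma fractionP (A : idomainType) (c : {fraction A}) :
  exists2 d : A, d != 0 & exists n : A, FracField.tofrac d * c = FracField.tofrac n.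
Proof.
elim/quotW: c => r; exists \d_r; [exact: denom_ratioP | exists \n_r].
unlock FracField.tofrac; rewrite -[LHS]FracField.pi_mul.
apply/eqmodP; rewrite /= FracField.equivfE /FracField.mulf.
by rewrite !numden_Ratio ?mulf_neq0 ?oner_neq0 ?mul1r ?mulr1 ?denom_ratioP // mulrC.
Qed.

Lemma clear_denominators (A : idomainType) (r : {poly {fraction A}}) :
  exists2 d : A, d != 0 &
    exists p, FracField.tofrac d *: r = map_poly (@FracField.tofrac A) p.
Proof.
elim/poly_ind: r => [|r c [d d0 [p Dp]]].
  by exists 1; rewrite ?oner_neq0 //; exists 0; rewrite scaler0 rmorph0.
have [e e0 [n Dn]] := fractionP c.
exists (e * d); first by rewrite mulf_neq0.
exists (e *: p * 'X + (d * n)%:P).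
rewrite rmorphD /= [map_poly _ (_ * 'X)]rmorphM /= map_polyX map_polyC map_polyZ /=.
rewrite !rmorphM /= -Dp -Dn -!mul_polyC !rmorphM /=; ring.
Qed.

(** * Polynomial functions on the curve and the place at infinity *)

Section Curve.
Variables (K : fieldType) (q u : nat) (X : nt_curve K q u).
Hypotheses (q_gt1 : (1 < q)%N) (u_gt0 : (0 < u)%N).
Implicit Types (P Q : place X) (f g : X).

Local Notation y := (nt_y X).
Local Notation x := (nt_x X).

(** The outer indeterminate stands for y and the inner one for x. *)
Definition poly_xy : {poly {poly K}} -> X := horner_eval y \o map_poly poly_x.
HB.instance Definition _ := GRing.RMorphism.on poly_xy.

Lemma poly_xyC a : poly_xy a%:P = poly_x a.
Proof. by rewrite /poly_xy /= map_polyC /horner_eval hornerC. Qed.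

Lemma poly_xyX : poly_xy 'X = y.
Proof. by rewrite /poly_xy /= map_polyX /horner_eval hornerX. Qed.

Lemma curve_eqn : y ^+ q + y = x ^+ u.
Proof.
have := minPolyxx 1 y; rewrite nt_eqn !hornerE.
by move/subr0_eq.
Qed.

(** The minimal polynomial of y has degree q, so f is a polynomial in y of degree below q over K(x);
    its coefficients have a common denominator d. *)
Lemma fraction_poly_xy f : exists2 d : {poly K}, d != 0 &
  exists2 p : {poly {poly K}}, (size p <= q)%N & poly_x d * f = poly_xy p.
Proof.
have f_in : f \in <<1; y>>%VS by rewrite nt_gen memvf.
have := Fadjoin_poly_eq f_in; have := size_Fadjoin_poly 1 y f.
have -> : adjoin_degree 1 y = q.
  apply/eqP; rewrite -eqSS -size_minPoly nt_eqn -addrA size_polyDl size_polyXn //.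
  rewrite (leq_ltn_trans (size_polyD _ _)) // gtn_max size_polyX size_polyN.
  rewrite ltnS q_gt1 (leq_ltn_trans (size_polyC_leq1 _)) // ltnS.
  exact: ltnW.
have /polyOver1P[r ->] := Fadjoin_polyOver 1 y f.
have [d d0 [p Dp]] := clear_denominators r.
rewrite size_map_poly => sz_r <-; exists d => //; exists p.
  have <- : size (map_poly (@FracField.tofrac {poly K}) p) = size p.
    apply: size_map_inj_poly => [a b /eqP|]; last exact: rmorph0.
    by rewrite tofrac_eq => /eqP.
  by rewrite -Dp size_scale ?tofrac_eq0.
rewrite /poly_xy /= /horner_eval /poly_x /=.
have -> : map_poly (in_alg X \o @FracField.tofrac {poly K}) p
          = map_poly (in_alg X) (map_poly (@FracField.tofrac {poly K}) p).
  exact: (map_poly_comp (in_alg X)).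
rewrite -Dp -mul_polyC rmorphM /= hornerM.
by rewrite map_polyC hornerC.
Qed.

Lemma x_neq0 : x != 0.
Proof. by rewrite -poly_xX poly_x_eq0 polyX_eq0. Qed.

Lemma y_neq0 : y != 0.
Proof.
apply: contraTneq (expf_neq0 u x_neq0) => y0.
by rewrite -curve_eqn y0 addr0 expr0n (gtn_eqF (ltnW q_gt1)) eqxx.
Qed.

(* [P] being proportional on all functions of degree less than [q] in y
   suffices, since these are all functions up to denominators in K[x]. *)
Lemma proportional_places_poly P Q (e e' : int) : 0 < e -> 0 < e' ->
  (forall p : {poly {poly K}}, (size p <= q)%N -> poly_xy p != 0 ->
     exists m : int, P (poly_xy p) = m * e /\ Q (poly_xy p) = m * e') ->
  e = 1 /\ P = Q.
Proof.
move=> e_gt0 e'_gt0 prop; apply: (proportional_places e_gt0 e'_gt0) => f f0.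
have [d d0 [p szp Dp]] := fraction_poly_xy f.
have dX0 : poly_x d != 0 :> X by rewrite poly_x_eq0.
have [m [Pm Qm]] : exists m : int, P (poly_x d) = m * e /\ Q (poly_x d) = m * e'.
  have szd : (size d%:P <= q)%N := leq_trans (size_polyC_leq1 _) (ltnW q_gt1).
  by have := prop d%:P szd; rewrite poly_xyC => /(_ dX0).
have [|k] := prop p szp; rewrite -Dp ?mulf_neq0 // !place_valM // Pm Qm => -[Pk Qk].
by exists (k - m); rewrite !mulrBl -Pk -Qk; lia.
Qed.

(** Were y without a pole, x^u = y^q + y would have none, and neither would x. So y has a pole, y^q
    dominates y, and u P(x) = q P(y); coprimality yields m. *)
Lemma infinity_slopes P : coprime q u -> at_infinity P ->
  exists2 m : int, 0 < m & P x = - (q%:Z * m) /\ P y = - (u%:Z * m).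
Proof.
move=> coqu Pinf; have [x0 y0] := (x_neq0, y_neq0).
have eqv : P (y ^+ q + y) = P x * u%:Z by rewrite curve_eqn valX.
have yneg : P y < 0.
  rewrite ltNge; apply/negP => y_ge0.
  case: Pinf => [xneg|]; last by rewrite ltNge y_ge0.
  have : integral P (y ^+ q + y).
    by apply: integralD; apply/integralP; rewrite ?valX ?mulr_ge0.
  by move/integralP; rewrite eqv nmulr_rge0 // => u_le0; lia.
have ltyq : P (y ^+ q) < P y by rewrite valX -{2}[P y]mulr1 ltr_nM2l //; lia.
have [_] := valD_lt (expf_neq0 q y0) y0 ltyq; rewrite eqv valX => eqxy.
have xneg : P x < 0 by nia.
have /dvdnP[m Dm] : (q %| `|P x|)%N.
  have := congr1 absz eqxy; rewrite !abszM !absz_nat => eqn.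
  by rewrite -(Gauss_dvdl _ coqu) eqn dvdn_mull.
have Px : P x = - (q%:Z * m%:Z) by move: xneg Dm; rewrite mulnC; lia.
exists m%:Z; first by case: m Px {Dm} xneg => // ->; rewrite mulr0 oppr0.
split; first exact: Px.
apply: (mulIf (x := q%:Z)); first by rewrite eqz_nat gtn_eqF // ltnW.
by rewrite -eqxy Px; ring.
Qed.

Lemma infinity_weight_x P (m : int) a : 0 < m -> P x = - (q%:Z * m) ->
  a != 0 -> P (poly_x a) = - ((q * (size a).-1)%N%:Z * m).
Proof.
move=> m_gt0 Px; elim/poly_ind: a => [|a c IH]; first by rewrite eqxx.
rewrite rmorphD rmorphM /= poly_xX -[poly_x c%:P]/(const c) size_MXaddC.
have [-> _|a0 _] := eqVneq a 0.
  rewrite rmorph0 mul0r add0r val_const /=.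
  by case: (c == 0); rewrite ?size_poly0 ?muln0 ?mul0r ?oppr0.
have Pax : P (poly_x a * x) = - ((q * size a)%N%:Z * m).
  rewrite place_valM ?x_neq0 ?poly_x_eq0 // IH // Px.
  by rewrite -{2}(prednK (n := size a)) ?size_poly_gt0 // mulnS; lia.
have [->|c0] := eqVneq c 0; first by rewrite rmorph0 addr0.
have cX0 : const c != 0 :> X by rewrite fmorph_eq0.
have ax0 : poly_x a * x != 0 by rewrite mulf_neq0 ?x_neq0 ?poly_x_eq0.
have lt0 : P (poly_x a * x) < P (const c).
  rewrite Pax val_const oppr_lt0 mulr_gt0 // ltz_nat muln_gt0 ltnW //.
  by rewrite size_poly_gt0.
by have [_ ->] := valD_lt ax0 cX0 lt0.
Qed.

(* The weights q i + u j with j < q are pairwise distinct, so that the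
   dominant monomial determines the order of the pole. *)
Lemma infinity_weight (p : {poly {poly K}}) : coprime q u ->
  p != 0 -> (size p <= q)%N ->
  exists i j, (j < size p)%N /\ forall P (m : int), 0 < m ->
    P x = - (q%:Z * m) -> P y = - (u%:Z * m) ->
    poly_xy p != 0 /\ P (poly_xy p) = - ((q * i + u * j)%N%:Z * m).
Proof.
move=> coqu; elim/poly_ind: p => [|p c IH]; first by rewrite eqxx.
rewrite rmorphD rmorphM /= poly_xyX poly_xyC size_MXaddC.
have [-> | p0] := eqVneq p 0.
  have [->|c0 _ _] := eqVneq c 0; first by rewrite mul0r add0r eqxx.
  exists (size c).-1, 0%N; split=> // P m m_gt0 Px _.
  rewrite rmorph0 mul0r add0r poly_x_eq0 c0 (infinity_weight_x m_gt0 Px) //.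
  by rewrite muln0 addn0.
move=> _ /= szp; have [i [j [ltj Pp]]] := IH p0 (ltnW szp).
have Ppy P (m : int) : 0 < m -> P x = - (q%:Z * m) -> P y = - (u%:Z * m) ->
    poly_xy p * y != 0 /\
    P (poly_xy p * y) = - ((q * i + u * j.+1)%N%:Z * m).
  move=> m_gt0 Px Py; have [pxy0 vpxy] := Pp P m m_gt0 Px Py.
  split; first by rewrite mulf_neq0 ?y_neq0.
  rewrite place_valM ?y_neq0 // vpxy Py mulnS (addnCA _ u) PoszD; ring.
have [->|c0] := eqVneq c 0.
  exists i, j.+1; split=> // P m m_gt0 Px Py.
  by rewrite rmorph0 addr0; apply: Ppy.
(* Equal weights would make q divide j + 1, a positive number below q. *)
have neqw : (q * i + u * j.+1 != q * (size c).-1)%N.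
  apply/eqP => eqw; suff : (q <= j.+1)%N by rewrite leqNgt (leq_ltn_trans ltj).
  have : (q %| u * j.+1)%N.
    by rewrite -(dvdn_addr _ (dvdn_mulr i (dvdnn q))) eqw dvdn_mulr.
  by rewrite Gauss_dvdr // => /dvdn_leq; apply.
have cX0 : poly_x c != 0 :> X by rewrite poly_x_eq0.
have [ltw|ltw|eqw] := ltngtP (q * i + u * j.+1) (q * (size c).-1); last first.
- by rewrite eqw eqxx in neqw.
- exists i, j.+1; split=> // P m m_gt0 Px Py.
  have [pxyy0 vpxyy] := Ppy P m m_gt0 Px Py.
  rewrite -vpxyy; apply: valD_lt => //.
  by rewrite (infinity_weight_x m_gt0 Px) // vpxyy ltrN2 ltr_pM2r // ltz_nat.
- exists (size c).-1, 0%N; split=> // P m m_gt0 Px Py.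
  have [pxyy0 vpxyy] := Ppy P m m_gt0 Px Py.
  rewrite addrC muln0 addn0 -(infinity_weight_x m_gt0 Px c0); apply: valD_lt => //.
  by rewrite (infinity_weight_x m_gt0 Px) // vpxyy ltrN2 ltr_pM2r // ltz_nat.
Qed.

(** The dominant monomial depends on the function alone, so P and Q are proportional with factors m
    and m'; normalization then forces m = 1 and P = Q. *)
Lemma infinity_unique P Q : coprime q u -> at_infinity P -> at_infinity Q ->
  [/\ P = Q, P x = - q%:Z & P y = - u%:Z].
Proof.
move=> coqu infP infQ.
have [m m_gt0 [Px Py]] := infinity_slopes coqu infP.
have [m' m'_gt0 [Qx Qy]] := infinity_slopes coqu infQ.
have [|m1 eqPQ] := @proportional_places_poly P Q m m' m_gt0 m'_gt0.
  move=> p szp; have [->|p0] := eqVneq p 0; first by rewrite rmorph0 eqxx.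
  have [i [j [_ Pp]]] := infinity_weight coqu p0 szp.
  exists (- (q * i + u * j)%N%:Z); rewrite !mulNr.
  by split; [have [] := Pp P m m_gt0 Px Py | have [] := Pp Q m' m'_gt0 Qx Qy].
by rewrite m1 !mulr1 in Px Py; split.
Qed.

(** At P the pole order of the monomial is its weight; at any other place x and y have no pole,
    since P is the only place at infinity. *)
Lemma monomial_RRspace P (alpha : int) i j : coprime q u -> at_infinity P ->
  (q * i + u * j)%N%:Z <= alpha ->
  RRspace (one_point_divisor alpha P) (x ^+ i * y ^+ j).
Proof.
move=> coqu infP le_alpha; right => Q.
rewrite place_valM ?expf_neq0 ?x_neq0 ?y_neq0 // !valX /one_point_divisor.
case: asboolP => [-> | neqQP].
  have [_ -> ->] := infinity_unique coqu infP infP.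
  by move: le_alpha; rewrite PoszD !PoszM; lia.
have finQ : ~ at_infinity Q.
  by move=> infQ; apply: neqQP; have [] := infinity_unique coqu infQ infP.
have Qx : 0 <= Q x by rewrite leNgt; apply/negP => ?; apply: finQ; left.
have Qy : 0 <= Q y by rewrite leNgt; apply/negP => ?; apply: finQ; right.
by rewrite oppr0 addr_ge0 // mulr_ge0.
Qed.

(** * Affine places and their coordinates *)

Lemma has_value_poly_x P x0 a : has_value P x x0 -> has_value P (poly_x a) a.[x0].
Proof.
move=> Px; elim/poly_ind: a => [|a c IH].
  by rewrite rmorph0 horner0 -(rmorph0 const); apply: has_value_const.
rewrite rmorphD rmorphM /= poly_xX -[poly_x c%:P]/(const c) hornerMXaddC.
by apply: has_valueD (has_value_const P c); apply: has_valueM.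
Qed.

Lemma has_value_poly_xy P x0 y0 (p : {poly {poly K}}) :
  has_value P x x0 -> has_value P y y0 ->
  has_value P (poly_xy p) p.[y0%:P].[x0].
Proof.
move=> Px Py; elim/poly_ind: p => [|p c IH].
  by rewrite rmorph0 !horner0 -(rmorph0 const); apply: has_value_const.
rewrite rmorphD rmorphM /= poly_xyX poly_xyC hornerMXaddC hornerD hornerM hornerC.
by apply: has_valueD (has_value_poly_x c Px); apply: has_valueM.
Qed.

Lemma has_value_curve_eqn P x0 y0 :
  has_value P x x0 -> has_value P y y0 -> y0 ^+ q + y0 = x0 ^+ u.
Proof.
move=> Px Py; apply: (@has_value_uniq _ _ _ _ P (x ^+ u)); last exact: has_valueX.
by rewrite -curve_eqn; apply: has_valueD => //; apply: has_valueX.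
Qed.

Lemma affine_coordinates P : rational_place P -> ~ at_infinity P ->
  exists c : K * K, has_value P x c.1 /\ has_value P y c.2.
Proof.
move=> ratP finP.
have [|x0 Px] := ratP x.
  by right; rewrite leNgt; apply/negP => ?; apply: finP; left.
have [|y0 Py] := ratP y.
  by right; rewrite leNgt; apply/negP => ?; apply: finP; right.
by exists (x0, y0).
Qed.

(* The affine curve is smooth at (x0, y0), with uniformizer x - x0: modulo the
   equation, (y - y0) b(y) = (x - x0) w(x) where b(y0) = 1. *)
Lemma local_uniformizer x0 y0 : q%:R = 0 :> K -> y0 ^+ q + y0 = x0 ^+ u ->
  exists b w : {poly K}, b.[y0] = 1 /\
    poly_xy (map_poly polyC b) * (y - const y0) = poly_x w * (x - const x0).
Proof.
move=> q0 eq0.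
have /factor_theorem[b Db] : root ('X^q + 'X - (y0 ^+ q + y0)%:P) y0.
  by rewrite rootE !hornerE subrr.
have /factor_theorem[w Dw] : root ('X^u - (x0 ^+ u)%:P) x0.
  by rewrite rootE !hornerE subrr.
exists b, w; split.
  (* b(y0) is the derivative of T^q + T at y0, namely q y0^(q-1) + 1 = 1, because q = 0 in K. *)
  have /(congr1 (fun p => p^`().[y0])) := Db.
  rewrite derivB derivD derivXn derivX derivC derivM derivXsubC !hornerE subrr.
  by rewrite hornerMn -mulr_natl q0 mul0r mulr0 !add0r subr0 => ->.
have liftE p : poly_xy (map_poly polyC p) = (map_poly (const : K -> X) p).[y].
  rewrite /poly_xy /= /horner_eval; congr (_.[y]).
  by rewrite -map_poly_comp.
have -> : poly_x w * (x - const x0) = poly_x (w * ('X - x0%:P)).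
  by rewrite rmorphM rmorphB.
have -> : poly_xy (map_poly polyC b) * (y - const y0)
          = poly_xy (map_poly polyC (b * ('X - y0%:P))).
  by rewrite !liftE rmorphM rmorphB /= map_polyX map_polyC /= !hornerE.
rewrite -Db -Dw liftE !rmorphB rmorphD /= map_polyXn map_polyX map_polyC /=.
rewrite rmorphXn /= poly_xX !hornerE curve_eqn eq0.
by [].
Qed.

(** With t = x - x0, every polynomial function is, up to functions of order 0 at both places, a
    power of t. So the orders at P and Q are the same multiple of P t and Q t. *)
Lemma affine_place_uniq P Q x0 y0 : q%:R = 0 :> K ->
  has_value P x x0 -> has_value P y y0 ->
  has_value Q x x0 -> has_value Q y y0 -> P = Q.
Proof.
move=> q0 Px Py Qx Qy; pose t := x - const x0.
have t0 : t != 0.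
  have -> : t = poly_x ('X - x0%:P) by rewrite rmorphB.
  by rewrite poly_x_eq0 polyXsubC_eq0.
have Pt : 0 < P t.
  by case/has_valueE: Px => // /eqP; rewrite -/t (negbTE t0).
have Qt : 0 < Q t.
  by case/has_valueE: Qx => // /eqP; rewrite -/t (negbTE t0).
have [b [w [b1 bw]]] := local_uniformizer q0 (has_value_curve_eqn Px Py).
have valb R : has_value R x x0 -> has_value R y y0 ->
    poly_xy (map_poly polyC b) != 0 /\ R (poly_xy (map_poly polyC b)) = 0.
  move=> Rx Ry; have := has_value_poly_xy (map_poly polyC b) Rx Ry.
  rewrite horner_map /= hornerC b1 => /has_value_neq0; apply.
  exact: oner_neq0.
have [b0 Pb] := valb P Px Py; have [_ Qb] := valb Q Qx Qy.
(* Induction on a bound for the order at P. A nonzero value at (x0, y0) gives m = 0; otherwise one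
   factor t is split off, which lowers the order at P. *)
suff prop n (p : {poly {poly K}}) : poly_xy p != 0 -> P (poly_xy p) <= n%:Z ->
    exists m : int, P (poly_xy p) = m * P t /\ Q (poly_xy p) = m * Q t.
  have [|_ //] := @proportional_places_poly P Q _ _ Pt Qt.
  by move=> p _ p0; apply: (prop `|P (poly_xy p)|%N); rewrite // lez_abs.
pose r := p.[y0%:P]; elim: n p @r => [|n IH] p r p0 Pp.
all: have [v0|v0] := eqVneq r.[x0] 0; last first.
all: try by exists 0; rewrite !mul0r;
  split; [have := has_value_poly_xy p Px Py | have := has_value_poly_xy p Qx Qy];
  case/has_value_neq0.
all: have := has_value_poly_xy p Px Py; rewrite -/r v0.
all: case/has_valueE => [/eqP|]; rewrite rmorph0 subr0 ?(negbTE p0) // => vp_gt0.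
  by move: Pp; rewrite leNgt vp_gt0.
have /factor_theorem[p1 Dp1] : root (p - r%:P) y0%:P.
  by rewrite rootE hornerD hornerN hornerC subrr.
have /factor_theorem[r1 Dr1] : root r x0 by rewrite rootE v0.
(* p equals p1 (y - y0) + r1 (x - x0); multiplying by b(y) turns b(y) (y - y0) into w(x) t. *)
pose p' := p1 * w%:P + map_poly polyC b * r1%:P.
have Dp : poly_xy (map_poly polyC b) * poly_xy p = t * poly_xy p'.
  have -> : poly_xy p = poly_xy p1 * (y - const y0) + poly_x r1 * t.
    rewrite -[p](subrK r%:P) Dp1 Dr1 rmorphD rmorphM /= poly_xyC rmorphM /=.
    by rewrite !rmorphB /= poly_xyX poly_xyC.
  rewrite /p' rmorphD !rmorphM /= !poly_xyC mulrDr mulrCA bw -/t; ring.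
have p'0 : poly_xy p' != 0.
  have : t * poly_xy p' != 0 by rewrite -Dp mulf_neq0.
  by rewrite mulf_eq0 negb_or => /andP[].
have valp (R : place X) : R (poly_xy (map_poly polyC b)) = 0 ->
    R (poly_xy p) = R t + R (poly_xy p').
  by move=> Rb; rewrite -place_valM // -Dp place_valM // Rb add0r.
have [|m [Pm Qm]] := IH p' p'0; first by move: Pp; rewrite valp //; lia.
by exists (1 + m); rewrite !valp // Pm Qm !mulrDl !mul1r.
Qed.

End Curve.

(** * Dual distance and the semicircle law *)

(** Translation by 1 permutes K, so adding 1 to every term leaves the sum of all elements
    unchanged. *)
Lemma card_natr0 (K : finFieldType) : #|K|%:R = 0 :> K.
Proof.
apply: (addrI (\sum_(a : K) a)); rewrite addr0.
by rewrite [RHS](reindex_inj (addIr 1)) big_split sumr_const.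
Qed.

Section Distance.
Variables (K : finFieldType) (n : nat) (C : {set 'rV[K]_n}).

Lemma dual_codeP (c : 'rV[K]_n) :
  reflect (forall w : 'rV[K]_n, w \in C -> \sum_i c 0 i * w 0 i = 0)
          (c \in dual_code C).
Proof.
rewrite inE; apply: (iffP forall_inP) => [h w /h/eqP // | h w /h ->].
by rewrite eqxx.
Qed.

Lemma dual_codeB c d :
  c \in dual_code C -> d \in dual_code C -> c - d \in dual_code C.
Proof.
move=> /dual_codeP hc /dual_codeP hd; apply/dual_codeP => w Cw.
transitivity (\sum_i c 0 i * w 0 i - \sum_i d 0 i * w 0 i).
  by rewrite -sumrB; apply: eq_bigr => i _; rewrite !mxE mulrBl.
by rewrite hc // hd // subrr.
Qed.

Lemma leq_min_distance m : (m <= n)%N ->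
  (forall c d : 'rV[K]_n, c \in C -> d \in C -> c != d -> (m <= hamming c d)%N) ->
  (m <= min_distance C)%N.
Proof.
move=> lemn le_m; apply: (big_ind (leq m)) => // [a b ? ?|c Cc].
  by rewrite leq_min; apply/andP.
apply: (big_ind (leq m)) => // [a b ? ?|d /andP[Cd neqcd]].
  by rewrite leq_min; apply/andP.
exact: le_m.
Qed.

End Distance.

(** For s = alpha + 1 this is the Goppa bound d >= alpha + 2 - 2g, with 2g = (q-1)(u-1). Monomials
    of weight below s have weight at most alpha, so a dual word annihilates their evaluations. *)
Lemma dual_min_distance (K : finFieldType) (q u : nat) (X : nt_curve K q u)
    (n : nat) (D : 'I_n -> place X) (P : place X) (alpha : int) (s : nat) :
  (1 < q)%N -> (0 < u)%N -> coprime q u -> q%:R = 0 :> K ->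
  affine_rational_points D -> at_infinity P ->
  let C := AGcode D (one_point_divisor alpha P) in
  nonzero_code (dual_code C) -> s%:Z <= alpha + 1 ->
  (s < min_distance (dual_code C) + (q - 1) * (u - 1))%N.
Proof.
move=> q_gt1 u_gt0 coqu q0 [injD affD] infP C [c0 C'c0 c0_neq0] le_s.
have /choice[xy Dxy] k : exists c : K * K,
    has_value (D k) (nt_x X) c.1 /\ has_value (D k) (nt_y X) c.2.
  have [ratD finD] := (affD (D k)).1 (ex_intro _ k erefl).
  exact: affine_coordinates.
pose x k := (xy k).1; pose y k := (xy k).2.
have eqn k : y k ^+ q + y k = x k ^+ u.
  by have [vx vy] := Dxy k; apply: has_value_curve_eqn vx vy.
have xy_inj k l : x k = x l -> y k = y l -> k = l.
  rewrite /x /y => eqx eqy; have [[vx vy] [wx wy]] := (Dxy k, Dxy l).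
  apply: injD; apply: affine_place_uniq q_gt1 u_gt0 _ _ _ _ q0 vx vy _ _.
    by rewrite eqx.
  by rewrite eqy.
have wt (c : 'rV[K]_n) : c \in dual_code C -> c != 0 ->
    (s < #|[set k | c 0%R k != 0%R]| + (q - 1) * (u - 1))%N.
  move=> /dual_codeP C'c c_neq0.
  apply: (feng_rao (x := x) (y := y)) => // [|i j lt_s].
    apply/existsP; rewrite -negb_forall; apply: contra c_neq0 => /forallP c0'.
    by apply/eqP/rowP => k; rewrite mxE; apply/eqP.
  have := C'c (\row_k (x k ^+ i * y k ^+ j)).
  rewrite /moment; under eq_bigr do rewrite mxE; apply.
  rewrite inE; apply/asboolP; exists (nt_x X ^+ i * nt_y X ^+ j); split.
    by apply: monomial_RRspace => //; lia.
  move=> k; rewrite mxE; have [vx vy] := Dxy k.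
  by apply: has_valueM; apply: has_valueX.
have le_d : (s.+1 - (q - 1) * (u - 1) <= min_distance (dual_code C))%N.
  (* The default value n of the minimum also satisfies the bound, being at least the weight of the
     nonzero dual word [c0]. *)
  apply: leq_min_distance => [|c d C'c C'd neqcd].
    rewrite leq_subLR addnC (leq_trans (wt _ C'c0 c0_neq0)) // leq_add2r.
    by rewrite -[leqRHS]card_ord max_card.
  rewrite leq_subLR addnC (leq_trans (wt (c - d) _ _)) ?dual_codeB ?subr_eq0 //.
  rewrite leq_add2r subset_leq_card //; apply/subsetP => k.
  by rewrite !inE !mxE subr_eq0.
by move: le_d; rewrite leq_subLR addnC.
Qed.

(** With c = sin^2 A and rho = sin^2 B, the expression is sin^2 (A + B). While c + rho <= 1, the
    cosine of A + B is nonnegative and decreases in c. *)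
Lemma semicircle_lt (R : rcfType) (rho a b : R) :
  0 <= rho -> 0 <= a -> a < b -> rho <= 1 - b ->
  (Num.sqrt (a * (1 - rho)) + Num.sqrt (rho * (1 - a))) ^+ 2 <
  (Num.sqrt (b * (1 - rho)) + Num.sqrt (rho * (1 - b))) ^+ 2.
Proof.
move=> rho0 a0 ltab le_rho.
(* cos^2 = 1 - sin^2 *)
have compl (c : R) : 0 <= c -> rho <= 1 - c ->
    (Num.sqrt (c * (1 - rho)) + Num.sqrt (rho * (1 - c))) ^+ 2 =
    1 - (Num.sqrt ((1 - c) * (1 - rho)) - Num.sqrt (rho * c)) ^+ 2.
  move=> c0 hc; have c1 : 0 <= 1 - c by lra.
  have r1 : 0 <= 1 - rho by lra.
  have sq (e : R) : 0 <= e -> Num.sqrt e ^+ 2 = e by exact: sqr_sqrtr.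
  rewrite !sqrtrM //; move: (sq _ c0) (sq _ c1) (sq _ r1) (sq _ rho0).
  move: (Num.sqrt c) (Num.sqrt (1 - c)) (Num.sqrt (1 - rho)) (Num.sqrt rho).
  move=> c' d' r' s' h1 h2 h3 h4.
  have -> : 1 = (c' ^+ 2 + d' ^+ 2) * (r' ^+ 2 + s' ^+ 2).
    by rewrite h1 h2 h3 h4; ring.
  ring.
rewrite !compl ?(ltW (le_lt_trans a0 ltab)) //; last by lra.
rewrite ltrD2l ltrN2.
have sq_lt : Num.sqrt ((1 - b) * (1 - rho)) < Num.sqrt ((1 - a) * (1 - rho)).
  by rewrite ltr_sqrt ?ltr_pM2r ?mulr_gt0 //; lra.
have sq_le : Num.sqrt (rho * a) <= Num.sqrt (rho * b).
  by apply: ler_wsqrtr; apply: ler_wpM2l => //; lra.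
have sq_ge : Num.sqrt (rho * b) <= Num.sqrt ((1 - b) * (1 - rho)).
  by apply: ler_wsqrtr; nra.
by rewrite ltr_pXn2r ?nnegrE //; lra.
Qed.

Lemma prime_power_gt1 q :
  (exists p k : nat, [/\ prime p, (0 < k)%N & q = (p ^ k)%N]) -> (1 < q)%N.
Proof.
case=> p [k [pr_p k_gt0 ->]].
by rewrite -(expn0 p) ltn_exp2l ?prime_gt1.
Qed.

Theorem proposition4p1 (R : realType) (q u : nat)
    (hq : exists p k : nat, [/\ prime p, (0 < k)%N & q = (p ^ k)%N])
    (hu0 : (0 < u)%N) (hu : (u %| q.+1)%N) (huq : u <> q.+1)
    (K : finFieldType) (hK : #|K| = (q ^ 2)%N)
    (nH nENT : nat)
    (hnH : nH = (q ^ 3)%N) (hnENT : nENT = (q + u * (q ^ 2 - q))%N)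
    (H : hermitian_curve K q) (E : nt_curve K q u)
    (PinfH : place H) (hPinfH : at_infinity PinfH)
    (PinfENT : place E) (hPinfENT : at_infinity PinfENT)
    (DH : 'I_nH -> place H) (hDH : affine_rational_points DH)
    (DENT : 'I_nENT -> place E) (hDENT : affine_rational_points DENT)
    (alphaH alphaENT : int) :
  let CH := AGcode DH (one_point_divisor alphaH PinfH) in
  let CENT := AGcode DENT (one_point_divisor alphaENT PinfENT) in
  let gENT := (((u - 1) * (q - 1)) %/ 2)%N in
  let lH := dual_radius CH in
  let lENT := dual_radius CENT in
  nonzero_code (dual_code CH) ->
  nonzero_code (dual_code CENT) ->
  (2 * gENT + 2 * ((nENT * lH) %/ nH) + 1)%N%:Z <= alphaENT ->
  (lH%:R / nH%:R < lENT%:R / nENT%:R :> R) /\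
  (forall r : nat, (r <= q ^ 2)%N ->
     let rho : R := r%:R / (q ^ 2)%:R in
     (nonsaturated CH rho -> nonsaturated CENT rho ->
        dqi_fraction CH rho < dqi_fraction CENT rho) /\
     (~ nonsaturated CH rho -> ~ nonsaturated CENT rho ->
        dqi_fraction CENT rho = 1 /\ dqi_fraction CH rho = 1)).
Proof.
move=> CH CENT gENT lH lENT _ nzENT le_alpha.
have q_gt1 := prime_power_gt1 hq; have q_gt0 := ltnW q_gt1.
have coqu : coprime q u by apply: (coprime_dvdr hu); apply: coprimenS.
have q0 : q%:R = 0 :> K.
  apply/eqP; have /eqP := card_natr0 K.
  by rewrite hK natrX expf_eq0.
have nH_gt0 : (0 < nH)%N by rewrite hnH expn_gt0 q_gt0.
have nENT_gt0 : (0 < nENT)%N by rewrite hnENT addn_gt0 q_gt0.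
(* The halving is exact: if q is even, then u divides the odd number q + 1, so u - 1 is even. *)
have gENT2 : (2 * gENT = (q - 1) * (u - 1))%N.
  rewrite mulnC divnK; first exact: mulnC.
  rewrite dvdn2 oddM !oddB //= !addbT negb_and !negbK.
  have [d Du] := dvdnP hu; have := congr1 odd Du; rewrite /= oddM.
  by case: (odd q); rewrite ?orbT // => /esym/andP[_ ->].
(* Let t be the floor on the left. The bound with s = 2g + 2t + 2 gives d >= 2t + 3 for the dual
   distance, hence a radius of at least t + 1. *)
have lt_l : ((nENT * lH) %/ nH < lENT)%N.
  have le_s : (2 * gENT + 2 * ((nENT * lH) %/ nH) + 2)%N%:Z <= alphaENT + 1.
    by lia.
  have := dual_min_distance q_gt1 hu0 coqu q0 hDENT hPinfENT nzENT le_s.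
  rewrite gENT2 -/CENT /lENT /dual_radius; lia.
(* The floor loses nothing: an integer exceeds the floor of a quotient exactly when it exceeds the
   quotient. *)
have lt_rad : lH%:R / nH%:R < lENT%:R / nENT%:R :> R.
  rewrite ltr_pdivrMr ?ltr0n // mulrAC ltr_pdivlMr ?ltr0n // -!natrM ltr_nat.
  by move: lt_l; rewrite ltn_divLR // mulnC.
split=> // r le_r rho; split=> [satH satENT | nsatH nsatENT]; last first.
  by rewrite /dqi_fraction; split; case: ifP.
rewrite /dqi_fraction [X in if X then _ else _]satH [X in _ < if X then _ else _]satENT.
by apply: semicircle_lt => //; rewrite divr_ge0.
Qed.
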